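(* Let $g\in\mathbb K[S,S^{-1}]$, $\lambda\in\mathbb K$, $H=2(X+g)D-\lambda$, $E=(X+g)^2D-\lambda(X+g)$, and let $r\in\mathbb Z_{\ge0}\cup\{\infty\}$ be the exact lower bandwidth of the associated monic eigenbasis $\{p_n\}_{n\ge0}$. The following conditions are equivalent: (i) $r<\infty$; (ii) $g(S)\in S^{-1}\mathbb K[S]$; (iii) $\nu_-(H)=-1$; (iv) $\nu_-(E)=-2$. When these conditions hold, $$r=\nu_+(H),\qquad \nu_+(E)=2r-1.$$
   Context: $\mathbb K$ is a field of characteristic zero. $\mathcal A=\mathbb K[x]\langle S,S^{-1}\rangle/(Sx-(x+1)S)$ consists of finite sums $\sum_j t_j(x)S^j$ ($j\in\mathbb Z$, $t_j\in\mathbb K[x]$) and acts on $\mathbb K[x]$ by $(Sf)(x)=f(x+1)$; $D=S-1$, $X=xS^{-1}$. (The triples $(E,H,1-S)$ with $E,H$ as in the claim are exactly the $\mathfrak{sl}_2$-triples in $\mathcal A$ with lowering operator $1-S$, each for a unique $(g,\lambda)$.) The associated monic eigenbasis: $p_n$ is the unique monic degree-$n$ polynomial with $Hp_n=(2n-\lambda)p_n$; equivalently $p_n=\exp(G(D))\,x(x-1)\cdots(x-n+1)$ where $G\in D\mathbb K[[D]]$, $G'(D)=g(D)$, with $g$ expanded at $D=0$ via $S=1+D$. The lower bandwidth of $\{p_n\}$ is the least integer $r\ge0$ such that $xp_n\in\operatorname{span}\{p_{n+1},p_n,\ldots,p_{n-r}\}$ for every $n\ge0$ (with $p_j=0$ for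 $j<0$), and $\infty$ if none exists. For nonzero $T=\sum_{j=a}^bt_j(x)S^j$ with $t_a,t_b\neq0$: $\nu_-(T)=a$, $\nu_+(T)=b$. *)

(* Defs.v *)
From HB Require Import structures.
From mathcomp Require Import all_boot all_order all_algebra.
From mathcomp.finmap Require Import finmap.
From mathcomp.multinomials Require Import monalg.

Set Implicit Arguments.
Unset Strict Implicit.
Unset Printing Implicit Defensive.

Import Order.TTheory GRing.Theory Num.Theory.
Local Open Scope ring_scope.

(* [shiftp j t] is t(x + j). *)
Definition shiftp (K : fieldType) (j : int) (t : {poly K}) : {poly K} :=
  t \Po ('X + (j%:~R)%:P).

(* The algebra K[x]<S, S^-1>/(Sx - (x+1)S) in normal form: the finite sum
   \sum_j t_j(x) S^j is the finitely supported family j |-> t_j, so that t_j is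
   T@_j, t S^j is << t *g j >>, and [msupp T] is the set of j with t_j != 0. *)
Definition shiftop (K : fieldType) : Type := {malg {poly K}[int]}.

HB.instance Definition _ (K : fieldType) := GRing.Zmodule.on (shiftop K).

Definition op_term (K : fieldType) (t : {poly K}) (j : int) : shiftop K :=
  << t *g j >>.

Definition op_one (K : fieldType) : shiftop K := op_term 1 0.

(* (t S^i)(u S^j) = t(x) u(x + i) S^(i + j), extended biadditively. *)
Definition op_mul (K : fieldType) (a b : shiftop K) : shiftop K :=
  \sum_(i <- msupp a) \sum_(j <- msupp b)
    op_term (a@_i * shiftp i b@_j) (i + j).

Definition op_scale (K : fieldType) (c : K) (a : shiftop K) : shiftop K :=
  op_mul (op_term c%:P 0) a.

Section ShiftPoly.
Variable K : fieldType.
Implicit Types (t u : {poly K}) (i j : int).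

Lemma shiftpD i : {morph shiftp (K := K) i : t u / t + u}.
Proof. by move=> t u; rewrite /shiftp raddfD. Qed.

Lemma shiftp0 i : shiftp i (0 : {poly K}) = 0.
Proof. by rewrite /shiftp raddf0. Qed.

Lemma shiftpM i : {morph shiftp (K := K) i : t u / t * u}.
Proof. by move=> t u; rewrite /shiftp rmorphM. Qed.

Lemma shiftpC i (c : K) : shiftp i c%:P = c%:P.
Proof. by rewrite /shiftp comp_polyC. Qed.

Lemma shiftp_id t : shiftp 0 t = t.
Proof. by rewrite /shiftp mulr0z polyC0 addr0 comp_polyXr. Qed.

Lemma shiftp_shiftp i j t : shiftp i (shiftp j t) = shiftp (i + j) t.
Proof.
rewrite /shiftp -comp_polyA comp_polyD comp_polyX comp_polyC.
by rewrite -addrA -polyCD -mulrzDr.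
Qed.

End ShiftPoly.

Section ShiftRing.
Variable K : fieldType.
Implicit Types (t u : {poly K}) (i j : int) (a b c : shiftop K).

Lemma op_termD j : {morph (fun t => op_term t j) : t u / t + u}.
Proof. exact: monalgUD. Qed.

Lemma op_term0 j : op_term (0 : {poly K}) j = 0.
Proof. exact: monalgU0. Qed.

Lemma op_mulw (d1 d2 : {fset int}) a b :
  (msupp a `<=` d1)%fset -> (msupp b `<=` d2)%fset ->
  op_mul a b = \sum_(i <- d1) \sum_(j <- d2)
                 op_term (a@_i * shiftp i b@_j) (i + j).
Proof.
move=> le1 le2; rewrite /op_mul (big_fset_incl _ le1) /=; last first.
  move=> i _ /mcoeff_outdom ->.
  by rewrite big1 // => j _; rewrite mul0r op_term0.
apply: eq_bigr => i _; rewrite (big_fset_incl _ le2) //=.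
by move=> j _ /mcoeff_outdom ->; rewrite shiftp0 mulr0 op_term0.
Qed.

Lemma op_mulDl : left_distributive (@op_mul K) +%R.
Proof.
move=> a b c.
pose d := (msupp a `|` msupp b)%fset.
rewrite (@op_mulw d (msupp c) (a + b)) ?msuppD_le //.
rewrite (@op_mulw d (msupp c) a) ?fsubsetUl //.
rewrite (@op_mulw d (msupp c) b) ?fsubsetUr //.
rewrite -big_split /=; apply: eq_bigr => i _.
rewrite -big_split /=; apply: eq_bigr => j _.
by rewrite mcoeffD mulrDl op_termD.
Qed.

Lemma op_mulDr : right_distributive (@op_mul K) +%R.
Proof.
move=> c a b.
pose d := (msupp a `|` msupp b)%fset.
rewrite (@op_mulw (msupp c) d c (a + b)) ?msuppD_le //.
rewrite (@op_mulw (msupp c) d c a) ?fsubsetUl //.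
rewrite (@op_mulw (msupp c) d c b) ?fsubsetUr //.
rewrite -big_split /=; apply: eq_bigr => i _.
rewrite -big_split /=; apply: eq_bigr => j _.
by rewrite mcoeffD shiftpD mulrDr op_termD.
Qed.

Lemma op_mul0l a : op_mul 0 a = 0.
Proof. by apply: (addrI (op_mul 0 a)); rewrite -op_mulDl !addr0. Qed.

Lemma op_mul0r a : op_mul a 0 = 0.
Proof. by apply: (addrI (op_mul a 0)); rewrite -op_mulDr !addr0. Qed.

Lemma op_mul_term t u i j :
  op_mul (op_term t i) (op_term u j) = op_term (t * shiftp i u) (i + j).
Proof.
rewrite (@op_mulw [fset i]%fset [fset j]%fset) ?msuppU_le //.
by rewrite !big_seq_fset1 !mcoeffUU.
Qed.

Lemma op_termE a : a = \sum_(j <- msupp a) op_term a@_j j.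
Proof. exact: monalgE. Qed.

Lemma op_ind (P : shiftop K -> Prop) :
  P 0 -> (forall a b, P a -> P b -> P (a + b)) ->
  (forall t j, P (op_term t j)) -> forall a, P a.
Proof.
by move=> P0 PD PU a; rewrite (op_termE a); apply: (big_ind P).
Qed.

Lemma op_mulA : associative (@op_mul K).
Proof.
move=> a b c; elim/op_ind: a => [|a a' IH IH'|t i].
- by rewrite !op_mul0l.
- by rewrite !op_mulDl IH IH'.
elim/op_ind: b => [|b b' IH IH'|u j].
- by rewrite !(op_mul0l, op_mul0r).
- by rewrite !(op_mulDl, op_mulDr) IH IH'.
elim/op_ind: c => [|c c' IH IH'|v k].
- by rewrite !op_mul0r.
- by rewrite !op_mulDr IH IH'.
by rewrite !op_mul_term shiftpM shiftp_shiftp mulrA addrA.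
Qed.

Lemma op_mul1l : left_id (op_one K) (@op_mul K).
Proof.
elim/op_ind => [|a a' IH IH'|t i]; first by rewrite op_mul0r.
- by rewrite op_mulDr IH IH'.
- by rewrite op_mul_term shiftp_id mul1r add0r.
Qed.

Lemma op_mul1r : right_id (op_one K) (@op_mul K).
Proof.
elim/op_ind => [|a a' IH IH'|t i]; first by rewrite op_mul0l.
- by rewrite op_mulDl IH IH'.
- by rewrite op_mul_term shiftpC mulr1 addr0.
Qed.

Lemma op_one_neq0 : op_one K != 0.
Proof. by rewrite /op_one /op_term monalgU_eq0 oner_eq0. Qed.

HB.instance Definition _ := GRing.Zmodule_isNzRing.Build (shiftop K)
  op_mulA op_mul1l op_mul1r op_mulDl op_mulDr op_one_neq0.

Lemma op_scaleA (c d : K) a : op_scale c (op_scale d a) = op_scale (c * d) a.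
Proof. by rewrite /op_scale op_mulA op_mul_term shiftpC polyCM addr0. Qed.

Lemma op_scale1 : left_id 1 (@op_scale K).
Proof. exact: op_mul1l. Qed.

Lemma op_scaleDr : right_distributive (@op_scale K) +%R.
Proof. by move=> c a b; exact: op_mulDr. Qed.

Lemma op_scaleDl a : {morph (op_scale (K := K))^~ a : c d / c + d}.
Proof. by move=> c d; rewrite /op_scale polyCD op_termD op_mulDl. Qed.

HB.instance Definition _ := GRing.Zmodule_isLmodule.Build K (shiftop K)
  op_scaleA op_scale1 op_scaleDr op_scaleDl.

Lemma op_scaleAl (c : K) a b : c *: (a * b) = c *: a * b.
Proof. exact: op_mulA. Qed.

HB.instance Definition _ := GRing.Lmodule_isLalgebra.Build K (shiftop K)
  op_scaleAl.

Lemma op_scaleAr (c : K) a b : c *: (a * b) = a * (c *: b).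
Proof.
change (op_mul (op_term c%:P 0) (op_mul a b) =
        op_mul a (op_mul (op_term c%:P 0) b)).
rewrite !op_mulA; congr op_mul.
elim/op_ind: a => [|a a' IH IH'|t i]; first by rewrite op_mul0l op_mul0r.
- by rewrite op_mulDl op_mulDr IH IH'.
- by rewrite !op_mul_term shiftpC shiftp_id mulrC add0r addr0.
Qed.

HB.instance Definition _ := GRing.Lalgebra_isAlgebra.Build K (shiftop K)
  op_scaleAr.

Lemma op_termM t u i j :
  op_term t i * op_term u j = op_term (t * shiftp i u) (i + j).
Proof. exact: op_mul_term. Qed.

End ShiftRing.

Definition op_x (K : fieldType) : shiftop K := op_term 'X 0.
Definition op_S (K : fieldType) : shiftop K := op_term 1 1.
Definition op_Sinv (K : fieldType) : shiftop K := op_term 1 (- 1).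
Definition op_D (K : fieldType) : shiftop K := op_S K - 1.
Definition op_X (K : fieldType) : shiftop K := op_x K * op_Sinv K.

(* The action on K[x] determined by (S f)(x) = f(x + 1). *)
Definition act (K : fieldType) (a : shiftop K) (f : {poly K}) : {poly K} :=
  \sum_(j <- msupp a) a@_j * shiftp j f.

(* a \in K[S, S^-1] *)
Definition laurentS (K : fieldType) (a : shiftop K) : Prop :=
  forall j : int, exists c : K, a@_j = c%:P.

(* a \in S^-1 K[S] *)
Definition Sinv_polyS (K : fieldType) (a : shiftop K) : Prop :=
  exists q : {poly K}, a = op_Sinv K * horner_alg (op_S K) q.

(* nu_-(T) and nu_+(T), the extremal exponents of S in T; both take the
   irrelevant value 0 at T = 0. *)
Definition nu_minus (K : fieldType) (a : shiftop K) : int :=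
  head 0 (sort <=%R (msupp a)).
Definition nu_plus (K : fieldType) (a : shiftop K) : int :=
  last 0 (sort <=%R (msupp a)).

Definition opH (K : fieldType) (g : shiftop K) (lambda : K) : shiftop K :=
  2 * (op_X K + g) * op_D K - lambda%:A.
Definition opE (K : fieldType) (g : shiftop K) (lambda : K) : shiftop K :=
  (op_X K + g) ^+ 2 * op_D K - lambda *: (op_X K + g).

Definition monic_eigenbasis (K : fieldType) (g : shiftop K) (lambda : K)
    (p : nat -> {poly K}) : Prop :=
  forall n, [/\ p n \is monic, size (p n) = n.+1
              & act (opH g lambda) (p n) = ((2 * n)%:R - lambda) *: p n].

(* x p_n lies in the span of p_(n+1), ..., p_(n-r) for all n.  The subtraction
   n - r is truncated, which drops the p_j with j < 0. *)
Definition lower_banded (K : fieldType) (p : nat -> {poly K}) (r : nat) : Prop :=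
  forall n, exists c : nat -> K,
    'X * p n = \sum_(n - r <= k < n.+2) c k *: p k.

(* The exact lower bandwidth, with [None] standing for infinity. *)
Definition lower_bandwidth (K : fieldType) (p : nat -> {poly K})
    (r : option nat) : Prop :=
  if r is Some m then
    lower_banded p m /\ (forall m', lower_banded p m' -> (m <= m')%N)
  else forall m, ~ lower_banded p m.

Section ActFacts.
Variable K : fieldType.
Implicit Types (a b : shiftop K) (t u f h : {poly K}) (i j : int).

Lemma act_w (d : {fset int}) a f : (msupp a `<=` d)%fset ->
  act a f = \sum_(j <- d) a@_j * shiftp j f.
Proof.
move=> le_d; rewrite /act (big_fset_incl _ le_d) //=.
by move=> j _ /mcoeff_outdom ->; rewrite mul0r.
Qed.

Lemma actDl f : {morph (act (K := K))^~ f : a b / a + b}.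
Proof.
move=> a b; pose d := (msupp a `|` msupp b)%fset.
rewrite (@act_w d (a + b)) ?msuppD_le // (@act_w d a) ?fsubsetUl //.
rewrite (@act_w d b) ?fsubsetUr // -big_split /=.
by apply: eq_bigr => j _; rewrite mcoeffD mulrDl.
Qed.

Lemma act0l f : act 0 f = 0.
Proof. by rewrite /act msupp0 big_seq_fset0. Qed.

Lemma actNl f : {morph (act (K := K))^~ f : a / - a}.
Proof. by move=> a; apply/eqP; rewrite -addr_eq0 -actDl addNr act0l. Qed.

Lemma actDr a : {morph act a : f h / f + h}.
Proof.
move=> f h; rewrite /act -big_split; apply: eq_bigr => j _.
by rewrite shiftpD mulrDr.
Qed.

Lemma actZr a (c : K) f : act a (c *: f) = c *: act a f.
Proof.
rewrite /act scaler_sumr; apply: eq_bigr => j _.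
by rewrite -mul_polyC shiftpM shiftpC mulrCA mul_polyC.
Qed.

Lemma act_term t j f : act (op_term t j) f = t * shiftp j f.
Proof. by rewrite (@act_w [fset j]%fset) ?msuppU_le // big_seq_fset1 mcoeffUU. Qed.

Lemma act1 f : act 1 f = f.
Proof. by rewrite act_term mul1r shiftp_id. Qed.

Lemma actM a b f : act (a * b) f = act a (act b f).
Proof.
elim/op_ind: a => [|a a' IH IH'|t i]; first by rewrite mul0r !act0l.
- by rewrite mulrDl !actDl IH IH'.
elim/op_ind: b => [|b b' IH IH'|u j].
- by rewrite mulr0 !act0l act_term shiftp0 mulr0.
- by rewrite mulrDr !actDl IH IH' -actDr.
by rewrite op_termM !act_term shiftpM shiftp_shiftp mulrA.
Qed.

Lemma actZl (c : K) a f : act (c *: a) f = c *: act a f.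
Proof.
have -> : c *: a = op_term c%:P 0 * a by [].
by rewrite actM act_term shiftp_id mul_polyC.
Qed.

Lemma act_x f : act (op_x K) f = 'X * f.
Proof. by rewrite act_term shiftp_id. Qed.

Lemma act_S f : act (op_S K) f = f \Po ('X + 1).
Proof. by rewrite act_term mul1r. Qed.

End ActFacts.

Section Facts.
Variable K : fieldType.
Implicit Types (a : shiftop K) (j : int).

Lemma op_msupp_neq0 a : a != 0 -> msupp a != fset0.
Proof.
by apply: contraNneq => a0; rewrite (op_termE a) a0 big_seq_fset0.
Qed.

Lemma nu_minusP a : a != 0 ->
  a@_(nu_minus a) != 0 /\ (forall j, a@_j != 0 -> nu_minus a <= j).
Proof.
move=> /op_msupp_neq0.
rewrite -cardfs_eq0 -(size_sort <=%R) /nu_minus => sz.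
have mem j : (a@_j != 0) = (j \in sort <=%R (msupp a)).
  by rewrite mem_sort mcoeff_neq0.
have : sorted <=%R (sort <=%R (msupp a)) by exact/sort_sorted/le_total.
rewrite !mem; case: (sort _ _) sz mem => // i s _ mem.
rewrite /= (path_sortedE le_trans) => /andP[/allP le_i _].
rewrite mem_head; split => // j; rewrite mem inE => /predU1P[->//|].
exact: le_i.
Qed.

Lemma nu_plusP a : a != 0 ->
  a@_(nu_plus a) != 0 /\ (forall j, a@_j != 0 -> j <= nu_plus a).
Proof.
move=> /op_msupp_neq0.
rewrite -cardfs_eq0 -(size_sort <=%R) /nu_plus => sz.
have mem j : (a@_j != 0) = (j \in sort <=%R (msupp a)).
  by rewrite mem_sort mcoeff_neq0.
have : sorted <=%R (sort <=%R (msupp a)) by exact/sort_sorted/le_total.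
rewrite !mem; case: (lastP (sort _ _)) sz mem => // s i _ mem.
rewrite last_rcons -rev_sorted rev_rcons /=.
rewrite (path_sortedE (rev_trans le_trans)) => /andP[/allP le_i _].
rewrite mem_rcons mem_head; split => // j.
rewrite mem mem_rcons inE => /predU1P[->//|js].
by apply: le_i; rewrite mem_rev.
Qed.

Lemma op_Sx : op_S K * op_x K = (op_x K + 1) * op_S K.
Proof.
rewrite mulrDl mul1r !op_termM [shiftp 1 'X]/shiftp comp_polyX.
by rewrite mul1r shiftpC mulr1 addr0 add0r -op_termD.
Qed.

Lemma op_SSinv : op_S K * op_Sinv K = 1.
Proof. by rewrite op_termM shiftpC mulr1 subrr. Qed.

Lemma op_SinvS : op_Sinv K * op_S K = 1.
Proof. by rewrite op_termM shiftpC mulr1 addNr. Qed.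

End Facts.

Section Eigenbasis.
Variable K : fieldType.
Hypothesis charK : [pchar K] =i pred0.
Variables (g : shiftop K) (lambda : K).
Hypothesis hg : laurentS g.
Implicit Types (f h q : {poly K}).

Let natf_neq0 n : (n%:R == 0 :> K) = (n == 0)%N.
Proof. by move/pcharf0P: charK => ->. Qed.

Lemma coef_shiftp j f k :
  (shiftp j f)`_k =
    \sum_(i < size f) f`_i * ((j%:~R) ^+ (i - k) *+ 'C(i, k)).
Proof.
rewrite /shiftp coef_comp_poly; apply: eq_bigr => i _; congr (_ * _).
rewrite addrC exprDn coef_sum.
have [lt_ik|le_ki] := ltnP i k.
  rewrite bin_small // mulr0n big1 // => l _.
  rewrite -polyC_exp coefMn mul_polyC coefZ coefXn.
  case: eqP => [kl|]; last by rewrite mulr0 mul0rn.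
  by have := ltn_ord l; rewrite -kl ltnS leqNgt lt_ik.
rewrite (bigD1 (Ordinal (le_ki : (k < i.+1)%N))) //= big1 ?addr0.
  by rewrite -polyC_exp coefMn mul_polyC coefZ coefXn eqxx mulr1.
move=> l /negPf ne_lk; rewrite -polyC_exp coefMn mul_polyC coefZ coefXn.
have -> : (k == l) = false by rewrite eq_sym; exact: ne_lk.
by rewrite mulr0 mul0rn.
Qed.

Lemma size_shiftp j f : (size (shiftp j f) <= size f)%N.
Proof.
apply/leq_sizeP => k le_k; rewrite coef_shiftp big1 // => i _.
by rewrite bin_small ?mulr0n ?mulr0 // (leq_trans (ltn_ord i)).
Qed.

Lemma size_act_g f : (size (act g f) <= size f)%N.
Proof.
rewrite /act; apply: (big_ind (fun h => size h <= size f)%N).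
- by rewrite size_poly0.
- by move=> h h' sh sh'; rewrite (leq_trans (size_polyD _ _)) // geq_max sh.
move=> j _; have [c ->] := hg j.
by rewrite mul_polyC (leq_trans (size_scale_leq _ _)) ?size_shiftp.
Qed.

Lemma coef_shiftp_top j f k : (size f <= k.+1)%N -> (shiftp j f)`_k = f`_k.
Proof.
move=> sf; rewrite coef_shiftp.
rewrite (big_ord_widen k.+1 (fun i => f`_i * (j%:~R ^+ (i - k) *+ 'C(i, k)))) //.
rewrite big_mkcond big_ord_recr /= big1 ?add0r => [|i _]; last first.
  by rewrite bin_small // mulr0n mulr0 if_same.
rewrite subnn binn mulr1; case: ifP => // /negbT; rewrite -leqNgt => le_k.
by rewrite nth_default.
Qed.

Lemma coef_shiftp_sub j f k : (size f <= k.+2)%N ->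
  (shiftp j f - f)`_k = j%:~R * f`_k.+1 *+ k.+1.
Proof.
move=> sf; rewrite coefB coef_shiftp.
rewrite (big_ord_widen k.+2 (fun i => f`_i * (j%:~R ^+ (i - k) *+ 'C(i, k)))) //.
have E i (F : nat -> K) : (if (i < size f)%N then f`_i * F i else 0) = f`_i * F i.
  by case: ltnP => // le_i; rewrite nth_default ?mul0r.
rewrite big_mkcond; under eq_bigr => i _ do
  rewrite (E i (fun i => j%:~R ^+ (i - k) *+ 'C(i, k))).
rewrite !big_ord_recr /= big1 ?add0r => [|i _]; last first.
  by rewrite bin_small // mulr0n mulr0.
rewrite subnn binn mulr1 subSnn binSn expr1 addrAC subrr add0r.
by rewrite mulrnAr mulrC.
Qed.

Lemma size_shiftp_sub j f k : (size f <= k.+1)%N ->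
  (size (shiftp j f - f)%R <= k)%N.
Proof.
move=> sf; apply/leq_sizeP => i le_ki.
by rewrite coefB coef_shiftp_top ?subrr // (leq_trans sf).
Qed.

Lemma act_opH f : act (opH g lambda) f =
  2%:R *: ('X * (f - shiftp (- 1) f) + act g (shiftp 1 f - f)) - lambda *: f.
Proof.
rewrite /opH mulr_natl mulrnAl actDl actNl actZl act1.
have aD h : act (op_D K) h = shiftp 1 h - h.
  by rewrite /op_D actDl actNl act1 act_term mul1r.
have aMn n (a : shiftop K) h : act (a *+ n) h = act a h *+ n.
  elim: n => [|n IH]; first by rewrite !mulr0n act0l.
  by rewrite !mulrS actDl IH.
rewrite aMn actM actDl aD -scaler_nat actM act_x act_term mul1r.
rewrite (_ : shiftp (- 1) (shiftp 1 f - f) = f - shiftp (- 1) f) //.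
have shN h : shiftp (- 1) (- h) = - shiftp (- 1) h.
  by rewrite /shiftp raddfN.
by rewrite shiftpD shN shiftp_shiftp addNr shiftp_id.
Qed.

Lemma act_opH_top f k : (size f <= k.+1)%N ->
  (size (act (opH g lambda) f - ((2 * k)%:R - lambda) *: f)%R <= k)%N.
Proof.
move=> sf; rewrite act_opH.
have szN : (size (f - shiftp (- 1) f)%R <= k)%N.
  by rewrite -size_polyN opprB size_shiftp_sub.
have szg : (size (act g (shiftp 1 f - f)) <= k)%N.
  by rewrite (leq_trans (size_act_g _)) // size_shiftp_sub.
apply/leq_sizeP => i; rewrite leq_eqVlt => /predU1P[<-|lt_ki]; last first.
  have f0 : f`_i = 0 by rewrite nth_default // (leq_trans sf).
  rewrite !(coefB, coefD, coefN, coefZ) coefXM f0.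
  rewrite [(act g _)`_i]nth_default ?(leq_trans szg) 1?ltnW //.
  case: i lt_ki f0 => // i lt_ki _ /=.
  by rewrite [(f - _)`_i]nth_default ?(leq_trans szN) // !(addr0, mulr0, subrr).
rewrite !(coefB, coefD, coefN, coefZ) coefXM.
rewrite [(act g _)`_k]nth_default // addr0.
case: k sf {szN szg} => [|k] sf /=.
  by rewrite muln0 mulr0n mulr0 !sub0r mulNr subrr.
have -> : (f - shiftp (- 1) f)`_k = k.+1%:R * f`_k.+1.
  rewrite -[LHS]opprK -coefN opprB coef_shiftp_sub //.
  by rewrite mulrN1z mulN1r mulNrn opprK mulr_natl.
by rewrite mulrBl natrM -mulrA subrr.
Qed.

Let L n f := act (opH g lambda) f - ((2 * n)%:R - lambda) *: f.

Let LD n : {morph L n : f h / f + h}.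
Proof. by move=> f h; rewrite /L actDr scalerDr opprD addrACA. Qed.

Let LZ n (c : K) f : L n (c *: f) = c *: L n f.
Proof. by rewrite /L actZr scalerBr scalerA mulrC -scalerA. Qed.

Let L_top n f k : (size f <= k.+1)%N ->
  (size (L n f - ((2 * k)%:R - (2 * n)%:R) *: f)%R <= k)%N.
Proof.
move=> /act_opH_top.
rewrite /L -addrA -opprD -scalerDl; congr (size (_ - _ *: f)%R <= k)%N.
by rewrite [RHS]addrC addrA subrK.
Qed.

Let gap_neq0 n k : (k < n)%N -> ((2 * k)%:R - (2 * n)%:R : K) != 0.
Proof.
move=> lt_kn; rewrite -opprB oppr_eq0 -natrB ?leq_mul2l ?(ltnW lt_kn) ?orbT //.
by rewrite natf_neq0 -mulnBr muln_eq0 subn_eq0 -ltnNge.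
Qed.

Let size_drop f k : (size f <= k.+1)%N -> f`_k = 0 -> (size f <= k)%N.
Proof.
move=> sf f0; apply/leq_sizeP => i; rewrite leq_eqVlt => /predU1P[<- //|lt].
by rewrite nth_default // (leq_trans sf).
Qed.

Let L_onto n k : (k <= n)%N -> forall f, (size f <= k)%N ->
  exists2 q : {poly K}, (size q <= k)%N & L n q = f.
Proof.
elim: k => [_ f|k IH lt_kn f sf].
  rewrite leqn0 size_poly_eq0 => /eqP->; exists 0; first by rewrite size_poly0.
  by have := LZ n 0 0; rewrite !scale0r.
pose d : K := (2 * k)%:R - (2 * n)%:R.
have d0 : d != 0 by exact: gap_neq0.
pose q1 := d^-1 *: f.
have sq1 : (size q1 <= k.+1)%N by rewrite (leq_trans (size_scale_leq _ _)).
have := L_top n sq1; rewrite scalerA mulfV // scale1r -size_polyN opprB.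
case/(IH (ltnW lt_kn)) => q2 sq2 e2; exists (q1 + q2).
  by rewrite (leq_trans (size_polyD _ _)) // geq_max sq1 (leq_trans sq2).
by rewrite LD e2 addrC subrK.
Qed.

Let L_inj n k : (k <= n)%N -> forall q, (size q <= k)%N -> L n q = 0 -> q = 0.
Proof.
elim: k => [_ q|k IH lt_kn q sq Lq].
  by rewrite leqn0 size_poly_eq0 => /eqP.
apply: (IH (ltnW lt_kn)) => //.
have := L_top n sq; rewrite Lq sub0r size_polyN.
by rewrite size_scale // gap_neq0.
Qed.

Lemma eigenbasis_ex n : exists f : {poly K}, [/\ f \is monic, size f = n.+1
  & act (opH g lambda) f = ((2 * n)%:R - lambda) *: f].
Proof.
have sX : (size ('X^n : {poly K}) <= n.+1)%N by rewrite size_polyXn.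
have := L_top n sX; rewrite subrr scale0r subr0.
case/(L_onto (leqnn n)) => q sq eq_q.
have lt_q : (size (- q)%R < size ('X^n : {poly K}))%N.
  by rewrite size_polyN size_polyXn.
exists ('X^n - q); split.
- by rewrite monicE lead_coefDl // lead_coefXn.
- by rewrite size_polyDl // size_polyXn.
apply/eqP; rewrite -subr_eq0 -/(L n ('X^n - q)) LD -scaleN1r LZ eq_q.
by rewrite scaleN1r subrr.
Qed.

Lemma eigenbasis_uniq n f h :
  f \is monic -> size f = n.+1 ->
  act (opH g lambda) f = ((2 * n)%:R - lambda) *: f ->
  h \is monic -> size h = n.+1 ->
  act (opH g lambda) h = ((2 * n)%:R - lambda) *: h -> f = h.
Proof.
move=> mf sf ef mh sh eh; apply/eqP; rewrite -subr_eq0; apply/eqP.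
apply: (L_inj (leqnn n)).
  apply: size_drop.
    by rewrite (leq_trans (size_polyD _ _)) // size_polyN sf sh maxnn.
  rewrite coefB; move: mf mh; rewrite !monicE /lead_coef sf sh /=.
  by move=> /eqP-> /eqP->; rewrite subrr.
by rewrite LD -scaleN1r LZ {1}/L ef subrr {1}/L eh subrr scaler0 addr0.
Qed.

End Eigenbasis.

(* Main.v *)
(* Since [H, D] = -2D and the eigenvectors are unique, D p_(n+1) = (n+1) p_n,
   hence Y = X + g acts as the raising operator p_n |-> p_(n+1); writing
   x = Y S - gS gives x p_n = p_(n+1) + n p_n - (gS) p_n.  Expanding gS in
   powers of D, which lower the index n, bandwidth at most m means that gS is a
   polynomial of degree at most m in D = S - 1: the truncated Taylor expansion
   of gS agrees with it on p_0, ..., p_m, the difference commutes with D, and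
   the band condition propagates its vanishing to all p_n.  Finally the extremal
   terms of H and E are read off those of Y, whose coefficient of S^-1 is
   x + const, never zero: nu_-(H) = nu_-(Y), nu_-(E) = 2 nu_-(Y),
   nu_+(H) = nu_+(Y) + 1 and nu_+(E) = 2 nu_+(Y) + 1. *)

From mathcomp.finmap Require Import finmap.
From mathcomp.multinomials Require Import monalg.
Require Import Defs.
From mathcomp Require Import all_boot all_order all_algebra.
From mathcomp Require Import ring zify.
Import Order.TTheory Num.Theory.
Import GRing.Theory.
Local Open Scope ring_scope.

Set Implicit Arguments.
Unset Strict Implicit.
Unset Printing Implicit Defensive.

(** * Coefficients of products in normal form; polynomials in S and in D *)

Section Coefficients.
Variable K : fieldType.
Implicit Types (a b : shiftop K) (t u : {poly K}) (c : K) (j k d e : int).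

Lemma coef_term t j k : (op_term t j)@_k = if k == j then t else 0.
Proof. by rewrite /op_term mcoeffU eq_sym mulrb. Qed.

Lemma coef_mull_term u j a k : (op_term u j * a)@_k = u * shiftp j a@_(k - j).
Proof.
elim/op_ind: a => [|a b IHa IHb|t i].
- by rewrite mulr0 !mcoeff0 shiftp0 mulr0.
- by rewrite mulrDr !mcoeffD IHa IHb shiftpD mulrDr.
rewrite op_termM !coef_term subr_eq [i + j]addrC.
by case: ifP => // _; rewrite shiftp0 mulr0.
Qed.

Lemma coef_mulr_term u j a k :
  (a * op_term u j)@_k = a@_(k - j) * shiftp (k - j) u.
Proof.
elim/op_ind: a => [|a b IHa IHb|t i].
- by rewrite mul0r !mcoeff0 mul0r.
- by rewrite mulrDl !mcoeffD IHa IHb mulrDl.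
rewrite op_termM !coef_term subr_eq.
by case: eqP => [->|]; rewrite ?addrK ?mul0r.
Qed.

Lemma coef_opM a b k :
  (a * b)@_k = \sum_(j <- msupp a) a@_j * shiftp j b@_(k - j).
Proof.
rewrite {1}(op_termE a) mulr_suml (raddf_sum (mcoeff k)).
by apply: eq_bigr => j _; rewrite /= coef_mull_term.
Qed.

(** Among the products of [a@_j] S^j with a term of exponent d + e - j, the hypothesis kills all but
    j = d. It is stated so as to serve at both the top and the bottom end of a square. *)
Lemma coef_opM_extremal a b d e :
    (forall j, a@_j != 0 -> j != d -> b@_(d + e - j) = 0) ->
  (a * b)@_(d + e) = a@_d * shiftp d b@_e.
Proof.
move=> b0; rewrite coef_opM.
have [d_in|/mcoeff_outdom a0] := boolP (d \in msupp a).
  rewrite (big_fsetD1 d) //= addrAC subrr add0r big_seq big1 ?addr0 // => j.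
  rewrite in_fsetD1 -mcoeff_neq0 => /andP[jd aj].
  by rewrite b0 // shiftp0 mulr0.
rewrite a0 mul0r big_seq big1 // => j j_in.
rewrite b0 ?shiftp0 ?mulr0 ?mcoeff_neq0 //.
by apply: contraTneq j_in => ->; rewrite -mcoeff_neq0 a0 eqxx.
Qed.

Lemma op_scalar_term c : c%:A = op_term c%:P 0 :> shiftop K.
Proof. exact: mulr1. Qed.

Lemma coef_opZ c a k : (c *: a)@_k = c *: a@_k.
Proof.
have -> : c *: a = op_term c%:P 0 * a by [].
by rewrite coef_mull_term subr0 shiftp_id mul_polyC.
Qed.

Lemma coef_opMD a k : (a * op_D K)@_k = a@_(k - 1) - a@_k.
Proof.
by rewrite mulrBr mulr1 mcoeffB coef_mulr_term shiftpC mulr1.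
Qed.

Lemma coef_op_X k : (op_X K)@_k = if k == - 1 then 'X else 0.
Proof.
rewrite /op_X /op_x coef_mull_term subr0 shiftp_id coef_term.
by case: ifP; rewrite ?mulr1 ?mulr0.
Qed.

Lemma op_expS n : op_S K ^+ n = op_term 1 n%:Z.
Proof.
elim: n => [//|n IH].
by rewrite exprS IH op_termM shiftpC mulr1 intS.
Qed.

Lemma coef_polyS (q : {poly K}) k :
  (horner_alg (op_S K) q)@_k = if k is Posz n then (q`_n)%:P else 0.
Proof.
have -> : horner_alg (op_S K) q = \sum_(i < size q) op_term (q`_i)%:P i%:Z.
  rewrite -{1}[q]coefK poly_def raddf_sum; apply: eq_bigr => i _ /=.
  rewrite linearZ rmorphXn /= horner_algX mulr_algl op_expS.
  by rewrite -[LHS]/(op_term _ 0 * _) op_termM add0r shiftpC mulr1.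
rewrite (raddf_sum (mcoeff k)).
under eq_bigr do rewrite /= coef_term.
case: k => n; last by rewrite big1.
have [lt_n|le_n] := ltnP n (size q).
  rewrite (bigD1 (Ordinal lt_n)) //= eqxx big1 ?addr0 // => i ni.
  by case: eqP => // -[ni']; case/eqP: ni; apply: val_inj.
rewrite nth_default // polyC0 big1 // => i _.
by case: eqP => // -[ni']; move: (ltn_ord i); rewrite -ni' ltnNge le_n.
Qed.

Lemma laurentSB a b : laurentS a -> laurentS b -> laurentS (a - b).
Proof.
move=> la lb j; have [c ac] := la j; have [c' bc] := lb j.
by exists (c - c'); rewrite mcoeffB ac bc polyCB.
Qed.

Lemma laurentS_polyS (q : {poly K}) : laurentS (horner_alg (op_S K) q).
Proof. by move=> [n|n]; rewrite coef_polyS; [exists q`_n | exists 0]. Qed.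

Lemma laurentS_mulS a : laurentS a -> laurentS (a * op_S K).
Proof.
move=> la j; have [c ac] := la (j - 1).
by exists c; rewrite coef_mulr_term shiftpC mulr1 ac.
Qed.

Lemma laurentS_commS a : laurentS a -> a * op_S K = op_S K * a.
Proof.
move=> la; apply/malgP => k; rewrite coef_mulr_term coef_mull_term.
by have [c ->] := la (k - 1); rewrite !shiftpC mul1r mulr1.
Qed.

Lemma laurentS_commD a : laurentS a -> a * op_D K = op_D K * a.
Proof. by move=> la; rewrite mulrBr mulrBl mulr1 mul1r laurentS_commS. Qed.

Lemma horner_alg_shift (q : {poly K}) :
  horner_alg (op_D K) q = horner_alg (op_S K) (q \Po ('X - 1)).
Proof.
elim/poly_ind: q => [|q c IH]; first by rewrite comp_poly0 !rmorph0.
rewrite comp_polyD comp_polyM comp_polyX comp_polyC 2!rmorphD !rmorphM /= -IH.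
by rewrite rmorphB rmorph1 /= !horner_algX !horner_algC.
Qed.

Lemma laurentS_polyD (q : {poly K}) : laurentS (horner_alg (op_D K) q).
Proof. by rewrite horner_alg_shift; exact: laurentS_polyS. Qed.

Lemma Sinv_polySE a :
  Sinv_polyS a <-> exists q : {poly K}, a * op_S K = horner_alg (op_S K) q.
Proof.
have lq q := laurentS_commS (laurentS_polyS q).
split=> -[q aq]; exists q.
  by rewrite aq -mulrA lq mulrA op_SinvS mul1r.
have la : a = horner_alg (op_S K) q * op_Sinv K.
  by rewrite -aq -mulrA op_SSinv mulr1.
rewrite la -[RHS]mulr1 -[in RHS]op_SSinv !mulrA -[_ * _ * op_S K]mulrA lq.
by rewrite mulrA op_SinvS mul1r.
Qed.

(** Multiplication by S moves every exponent up by one, so the exponents -1, ..., m - 1 of [a]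
    become the exponents 0, ..., m of a polynomial in S of degree at most m. *)
Lemma polyS_supportP a m : laurentS a ->
  (exists2 q : {poly K}, (size q <= m.+1)%N
     & a * op_S K = horner_alg (op_S K) q)
  <-> (forall j, a@_j != 0 -> - 1 <= j < m%:Z).
Proof.
move=> la; split=> [[q sq aq] j|supp].
  have := congr1 (mcoeff (j + 1)) aq.
  rewrite coef_mulr_term addrK shiftpC mulr1 coef_polyS => ->.
  case E: (j + 1) => [n|n]; last by rewrite eqxx.
  have [le_n|lt_n _] := leqP (size q) n; first by rewrite nth_default ?eqxx.
  have := leq_trans lt_n sq; lia.
have lS := laurentS_mulS la.
(* The coefficients of [a * op_S K] are constant polynomials, so their constant terms determine
   them. *)
pose q := \poly_(i < m.+1) ((a * op_S K)@_(i%:Z))`_0.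
exists q; first exact: size_poly.
apply/malgP => k; rewrite coef_polyS.
have out : (k < 0) || (m%:Z < k) -> (a * op_S K)@_k = 0.
  rewrite coef_mulr_term shiftpC mulr1 => lt; apply/eqP.
  by apply: contraTT lt => /supp; lia.
case: k out => n out; last by rewrite out.
rewrite coef_poly; case: ltnP => le_n; last by rewrite out //; lia.
by have [c ->] := lS n; rewrite coefC.
Qed.

End Coefficients.

Lemma act0r (K : fieldType) (a : shiftop K) : act a 0 = 0.
Proof. by have := actZr a 0 0; rewrite !scale0r. Qed.

Lemma coef_pred_size_neq0 (K : fieldType) (f : {poly K}) n :
  size f = n.+1 -> f`_n != 0.
Proof.
by move=> sf; rewrite -[n]/n.+1.-1 -sf -lead_coefE lead_coef_eq0
  -size_poly_eq0 sf.
Qed.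

(** * The action in characteristic zero: faithfulness and the kernel of D *)

Section CharacteristicZero.
Variable K : fieldType.
Hypothesis charK : [pchar K] =i pred0.

Lemma natf_neq0_pchar0 n : (n%:R == 0 :> K) = (n == 0)%N.
Proof. by move/pcharf0P: charK => ->. Qed.

Lemma intr_eq0_pchar0 (m : int) : (m%:~R == 0 :> K) = (m == 0).
Proof.
case: m => n; first by rewrite -[Posz n]/(n%:Z) -pmulrn natf_neq0_pchar0.
by rewrite NegzE mulrNz oppr_eq0 -pmulrn natf_neq0_pchar0.
Qed.

(* The test polynomial vanishes at every exponent of [a] but [k], so that
   evaluating its image at 0 isolates the coefficient of [S^k]. *)
Lemma laurentS_act_faithful (a : shiftop K) :
  laurentS a -> (forall f, act a f = 0) -> a = 0.
Proof.
move=> la a0; apply/malgP => k; rewrite mcoeff0; apply/eqP.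
have [//|ak] := eqVneq; have k_in : k \in msupp a by rewrite -mcoeff_neq0.
pose f : {poly K} := \prod_(i <- (msupp a `\ k)%fset) ('X - (i%:~R)%:P).
have fE (x : K) : f.[x] = \prod_(i <- (msupp a `\ k)%fset) (x - i%:~R).
  by rewrite horner_prod; apply: eq_bigr => i _; rewrite !hornerE.
have shE j : (shiftp j f).[0] = f.[j%:~R].
  by rewrite /shiftp horner_comp !hornerE.
have := congr1 (fun q : {poly K} => q.[0]) (a0 f).
rewrite /act horner_sum horner0 (big_fsetD1 k) //= big_seq big1 => [|i i_in].
  rewrite addr0; have [c akc] := la k; move: ak; rewrite akc polyC_eq0 => c0.
  move/eqP; rewrite !hornerE shE mulf_eq0 (negPf c0) /= fE.
  apply: contraTT => _; rewrite prodf_seq_neq0; apply/allP => i.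
  rewrite in_fsetD1 => /andP[ik _].
  by rewrite -mulrzBr intr_eq0_pchar0 subr_eq0 eq_sym.
by rewrite !hornerE shE fE (big_fsetD1 i) //= subrr mul0r mulr0.
Qed.

Lemma act_D f : act (op_D K) f = shiftp 1 f - f.
Proof. by rewrite /op_D actDl actNl act1 act_term mul1r. Qed.

Lemma size_act_D (f : {poly K}) n :
  (size f <= n.+1)%N -> (size (act (op_D K) f) <= n)%N.
Proof. by move=> sf; rewrite act_D size_shiftp_sub. Qed.

Lemma coef_act_D (f : {poly K}) n :
  (size f <= n.+2)%N -> (act (op_D K) f)`_n = f`_n.+1 *+ n.+1.
Proof. by move=> sf; rewrite act_D coef_shiftp_sub // mul1r. Qed.

(** If f has degree n + 1, the coefficient of x^n in D f is n + 1 times the leading coefficient of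
    f, which is nonzero in characteristic zero. *)
Lemma act_D_eq0 (f : {poly K}) : act (op_D K) f = 0 -> f = (f`_0)%:P.
Proof.
move=> Df; apply: size1_polyC; case E: (size f) => [|[|n]] //.
have := @coef_act_D f n; rewrite E leqnn Df coef0 => /(_ isT)/esym/eqP.
rewrite -mulr_natr mulf_eq0 natf_neq0_pchar0 orbF.
by rewrite (negPf (coef_pred_size_neq0 E)).
Qed.

End CharacteristicZero.

(** * Spans over a window of indices, for a family with one polynomial in each degree *)

Section Span.
Variables (K : fieldType) (p : nat -> {poly K}).
Implicit Types (f : {poly K}) (m n k : nat).

(** The window is half-open, so that [lower_banded p r] unfolds to [pspan p (n - r) n.+2 ('X * p n)]
    for all n. *)
Definition pspan m n f := exists c : nat -> K, f = \sum_(m <= k < n) c k *: p k.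

Lemma pspan0 m n : pspan m n 0.
Proof. by exists (fun=> 0); rewrite big1 // => k _; rewrite scale0r. Qed.

Lemma pspanD m n f h : pspan m n f -> pspan m n h -> pspan m n (f + h).
Proof.
case=> c -> [d ->]; exists (fun k => c k + d k).
by rewrite -big_split; apply: eq_bigr => k _; rewrite scalerDl.
Qed.

Lemma pspanZ m n (x : K) f : pspan m n f -> pspan m n (x *: f).
Proof.
case=> c ->; exists (fun k => x * c k).
by rewrite scaler_sumr; apply: eq_bigr => k _; rewrite scalerA.
Qed.

Lemma pspanB m n f h : pspan m n f -> pspan m n h -> pspan m n (f - h).
Proof. by move=> sf sh; rewrite -scaleN1r; apply/pspanD/pspanZ. Qed.

Lemma pspan_sum (I : Type) (s : seq I) (P : pred I) (F : I -> {poly K}) m n :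
  (forall i, P i -> pspan m n (F i)) -> pspan m n (\sum_(i <- s | P i) F i).
Proof.
by move=> sF; apply: big_ind => //; [exact: pspan0 | move=> *; exact: pspanD].
Qed.

Lemma pspan_mem m n k : (m <= k < n)%N -> pspan m n (p k).
Proof.
move=> k_in; exists (fun i => (i == k)%:R).
rewrite (bigD1_seq k) ?mem_index_iota ?iota_uniq //= eqxx scale1r big1.
  by rewrite addr0.
by move=> i /negPf ->; rewrite scale0r.
Qed.

Hypothesis size_p : forall n, size (p n) = n.+1.

(** Triangularity: subtracting the multiple of [p n] with the same coefficient of x^n lowers the
    degree. *)
Lemma pspan_size n f : (size f <= n)%N -> pspan 0 n f.
Proof.
elim: n f => [|n IH] f sf.
  by move: sf; rewrite leqn0 size_poly_eq0 => /eqP ->; exact: pspan0.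
pose x := f`_n / (p n)`_n.
have pn0 : (p n)`_n != 0 by exact: coef_pred_size_neq0.
have [c fc] : pspan 0 n (f - x *: p n).
  apply: IH; apply/leq_sizeP => i; rewrite leq_eqVlt coefB coefZ.
  case/predU1P => [<-|lt_ni]; first by rewrite divfK // subrr.
  by rewrite !nth_default ?mulr0 ?subr0 ?size_p // (leq_trans sf).
exists (fun k => if (k < n)%N then c k else x).
rewrite big_nat_recr //= ltnn -[LHS](subrK (x *: p n)) fc; congr (_ + _).
by rewrite !big_nat; apply: eq_bigr => k /andP[_ ->].
Qed.

(** Distinct degrees give linear independence, and a window starting at 1 misses [p 0]. *)
Lemma pspan_const_eq0 n (x : K) : pspan 1 n (x *: p 0) -> x = 0.
Proof.
have indep (c : nat -> K) N : \sum_(0 <= k < N) c k *: p k = 0 ->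
    forall k, (k < N)%N -> c k = 0.
  elim: N => // N IH; rewrite big_nat_recr //= => sum0.
  suff cN : c N = 0.
    move: sum0; rewrite cN scale0r addr0 => /IH c0 k.
    by rewrite ltnS leq_eqVlt => /predU1P[->|/c0].
  have := congr1 (fun q : {poly K} => q`_N) sum0; rewrite coefD coef_sum coef0.
  rewrite big_nat big1 ?add0r => [|k /andP[_ kN]].
    move/eqP; rewrite coefZ mulf_eq0 => /orP[/eqP//|].
    by rewrite (negPf (coef_pred_size_neq0 (size_p N))).
  by rewrite coefZ nth_default ?mulr0 // size_p.
case: n => [|n] [c xE].
  move: xE; rewrite big_geq // => /eqP.
  by rewrite scaler_eq0 -size_poly_eq0 size_p orbF => /eqP.
apply: oppr_inj; rewrite oppr0.
(* Moving [x *: p 0] across gives a linear relation whose coefficient at index 0 is -x. *)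
apply: (indep (fun k => if k is k'.+1 then c k else - x) n.+1 _ 0%N) => //.
rewrite big_nat_recl // scaleNr xE big_add1 /=.
by rewrite addrC subrr.
Qed.

End Span.

(** * Ladder relations of the eigenbasis, and the band condition as a degree bound on gS *)

Section EigenbasisRelations.
Variable K : fieldType.
Hypothesis charK : [pchar K] =i pred0.
Variables (g : shiftop K) (lambda : K).
Hypothesis hg : laurentS g.
Let Y : shiftop K := op_X K + g.

Lemma opHE : opH g lambda = (Y * op_D K) *+ 2 - lambda%:A.
Proof. by rewrite /opH mulr_natl mulrnAl. Qed.

(** X S = x while S X = x + 1, and g commutes with S; hence [D, Y] = 1. *)
Lemma raising_D : Y * op_D K = op_D K * Y - 1.
Proof.
have XS : op_X K * op_S K = op_x K by rewrite -mulrA op_SinvS mulr1.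
have SX : op_S K * op_X K = op_x K + 1.
  by rewrite mulrA op_Sx -mulrA op_SSinv mulr1.
rewrite mulrBr mulrBl mulr1 mul1r mulrDl mulrDr XS SX laurentS_commS //.
by rewrite [RHS]addrAC [op_x K + 1 + _]addrAC addrK.
Qed.

(** Consequence of [D, Y] = 1: D sends an eigenvector of H for mu to one for mu - 2, or to 0. *)
Lemma opH_D : opH g lambda * op_D K = op_D K * opH g lambda - op_D K *+ 2.
Proof.
rewrite opHE [LHS]mulrBl [op_D K * (_ - _)]mulrBr mulr_algl mulr_algr.
rewrite mulrnAl mulrnAr.
by rewrite raising_D mulrBl -mulrA -raising_D mul1r mulrnBl addrAC.
Qed.

Variable p : nat -> {poly K}.
Hypothesis hp : monic_eigenbasis g lambda p.

Lemma size_eigenbasis n : size (p n) = n.+1.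
Proof. by have [] := hp n. Qed.

Lemma eigenbasis0 : p 0 = 1.
Proof.
have [+ sp _] := hp 0; rewrite monicE lead_coefE sp /= => /eqP p0.
by rewrite (size1_polyC (eq_leq sp)) p0.
Qed.

(** D lowers the eigenvalue by 2 and, in characteristic zero, the degree by exactly 1; dividing by n
    + 1 makes the image monic, and [eigenbasis_uniq] identifies it. *)
Lemma act_D_eigenbasis n : act (op_D K) (p n.+1) = n.+1%:R *: p n.
Proof.
have n0 : n.+1%:R != 0 :> K by rewrite natf_neq0_pchar0.
have [mon_p sp eig_p] := hp n.+1; have [mon_q sq eig_q] := hp n.
have lead_p : (p n.+1)`_n.+1 = 1.
  by move: mon_p; rewrite monicE lead_coefE sp => /eqP.
pose q := n.+1%:R^-1 *: act (op_D K) (p n.+1).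
have qn : q`_n = 1 by rewrite coefZ coef_act_D ?sp // lead_p mulVf.
have sizeq : size q = n.+1.
  apply/eqP; rewrite eqn_leq (leq_trans (size_scale_leq _ _)); last first.
    by rewrite size_act_D ?sp.
  rewrite ltnNge; apply/negP => /leq_sizeP/(_ n (leqnn n))/eqP.
  by rewrite qn oner_eq0.
have <- : q = p n.
  apply: (eigenbasis_uniq charK hg (lambda := lambda) (n := n)) => //.
    by rewrite monicE lead_coefE sizeq qn.
  rewrite actZr -actM opH_D mulr2n actDl actNl [act (op_D K + _) _]actDl.
  rewrite actM eig_p actZr /q scalerA [_ * _^-1]mulrC -scalerA.
  rewrite -mulr2n -[_ *+ 2]scaler_nat -scalerBl mulnS natrD.
  by congr (_ *: (_ *: _)); ring.
by rewrite scalerA mulfV // scale1r.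
Qed.

(** The eigenvalue equation of [p n.+1] reads 2 Y D p_(n+1) = 2(n+1) p_(n+1); inserting D p_(n+1) =
    (n+1) p_n leaves the nonzero factor 2(n+1) to cancel. *)
Lemma act_raising_eigenbasis n : act Y (p n) = p n.+1.
Proof.
have n0 : n.+1%:R != 0 :> K by rewrite natf_neq0_pchar0.
have [_ _] := hp n.+1.
rewrite opHE actDl actNl actZl act1 scalerBl => /addIr.
rewrite mulr2n actDl actM act_D_eigenbasis actZr -mulr2n -scaler_nat scalerA.
rewrite -natrM => /scalerI; apply.
by rewrite natf_neq0_pchar0.
Qed.

Lemma act_S_eigenbasis n :
  act (op_S K) (p n) = p n + n%:R *: p n.-1.
Proof.
have -> : op_S K = 1 + op_D K by rewrite addrC subrK.
rewrite actDl act1; case: n => [|n] /=; last by rewrite act_D_eigenbasis.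
by rewrite scale0r act_D eigenbasis0 shiftpC subrr.
Qed.

(** From x = YS - gS and S p_n = p_n + n p_(n-1). Only gS can produce terms below p_n. *)
Lemma eigenbasis_mulX n :
  'X * p n = p n.+1 + n%:R *: p n - act (g * op_S K) (p n).
Proof.
have x_def : op_x K = Y * op_S K - g * op_S K.
  by rewrite mulrDl addrK -mulrA op_SinvS mulr1.
rewrite -act_x x_def actDl actNl actM act_S_eigenbasis actDr actZr.
rewrite !act_raising_eigenbasis; case: n => [|n] //=.
by rewrite !scale0r.
Qed.

(** For k > n the falling factorial vanishes, so the truncated index [n - k] does no harm. *)
Lemma act_expD_eigenbasis k n :
  act (op_D K ^+ k) (p n) = (n ^_ k)%:R *: p (n - k).
Proof.
elim: k n => [|k IH] n; first by rewrite act1 subn0 scale1r.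
rewrite exprSr actM; case: n => [|n].
  by rewrite eigenbasis0 act_D shiftpC subrr act0r ffact_small ?scale0r.
by rewrite act_D_eigenbasis actZr IH scalerA -natrM subSS.
Qed.

Lemma act_polyD_eigenbasis (q : {poly K}) n :
  act (horner_alg (op_D K) q) (p n) =
  \sum_(k < size q) (q`_k * (n ^_ k)%:R) *: p (n - k).
Proof.
rewrite -{1}[q]coefK poly_def raddf_sum /=.
rewrite (big_morph _ (actDl (p n)) (act0l (p n))); apply: eq_bigr => k _.
rewrite linearZ rmorphXn /= horner_algX mulr_algl actZl.
by rewrite act_expD_eigenbasis scalerA.
Qed.

Lemma act_eigenbasis_eq0 (a : shiftop K) :
  laurentS a -> (forall n, act a (p n) = 0) -> a = 0.
Proof.
move=> la ap; apply: (laurentS_act_faithful charK) => // f.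
have [c ->] := pspan_size size_eigenbasis (leqnn (size f)).
rewrite (big_morph _ (actDr a) (act0r a)) big1 // => k _.
by rewrite actZr ap scaler0.
Qed.

(** Since [a] commutes with D, applying D to a p_n gives n a p_(n-1) = 0, and the kernel of D
    consists of the constants. *)
Lemma laurentS_eigenbasis_const (a : shiftop K) n : laurentS a ->
  (forall k, (k < n)%N -> act a (p k) = 0) ->
  exists c : K, act a (p n) = c *: p 0.
Proof.
move=> la a0; exists (act a (p n))`_0.
rewrite eigenbasis0 alg_polyC; apply: (act_D_eq0 charK).
rewrite -actM -laurentS_commD // actM.
case: n a0 => [|n] a0.
  by rewrite eigenbasis0 act_D shiftpC subrr act0r.
by rewrite act_D_eigenbasis actZr a0 // scaler0.
Qed.

Lemma laurentS_taylor (a : shiftop K) m : laurentS a ->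
  exists2 q : {poly K}, (size q <= m)%N
    & forall k, (k < m)%N -> act (a - horner_alg (op_D K) q) (p k) = 0.
Proof.
move=> la; elim: m => [|m [q sq qm]]; first by exists 0; rewrite ?size_poly0.
have lq := laurentSB la (laurentS_polyD q).
have [c cE] := laurentS_eigenbasis_const lq qm.
have fact0 : m`!%:R != 0 :> K.
  by rewrite (natf_neq0_pchar0 charK) -lt0n fact_gt0.
(* D^m kills p_k for k < m and sends p_m to m! p_0, so this term repairs index m without disturbing
   the earlier ones. *)
exists (q + (c / m`!%:R) *: 'X^m).
  rewrite (leq_trans (size_polyD _ _)) // geq_max (leq_trans sq) //.
  by rewrite (leq_trans (size_scale_leq _ _)) // size_polyXn.
move=> k; rewrite ltnS rmorphD /= linearZ rmorphXn /= horner_algX mulr_algl.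
rewrite opprD addrA actDl actNl actZl act_expD_eigenbasis leq_eqVlt.
case/predU1P => [->|lt_km]; last first.
  by rewrite qm // ffact_small // !(scale0r, scaler0) subr0.
by rewrite cE subnn ffactnn scalerA divfK // subrr.
Qed.

Lemma lower_bandedP m : lower_banded p m <->
  exists2 q : {poly K}, (size q <= m.+1)%N & g * op_S K = horner_alg (op_D K) q.
Proof.
have lgS := laurentS_mulS hg.
have span_q (q : {poly K}) n : (size q <= m.+1)%N ->
    pspan p (n - m) n.+2 (act (horner_alg (op_D K) q) (p n)).
  move=> sq; rewrite act_polyD_eigenbasis; apply: pspan_sum => k _.
  have le_km : (k <= m)%N by rewrite -ltnS (leq_trans _ sq).
  by apply/pspanZ/pspan_mem; lia.
have span_x n : pspan p (n - m) n.+2 (p n.+1 + n%:R *: p n).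
  by apply/pspanD/pspanZ; apply: pspan_mem; lia.
split=> [band | [q sq gq] n]; last first.
  by rewrite eigenbasis_mulX gq; apply/pspanB/span_q.
have [q sq q_low] := laurentS_taylor m.+1 lgS.
exists q => //; apply/eqP; rewrite -subr_eq0; apply/eqP.
have la := laurentSB lgS (laurentS_polyD q).
apply: act_eigenbasis_eq0 => //; elim/ltn_ind => n IH.
have [/q_low //|lt_mn] := ltnP n m.+1.
have [c cE] := laurentS_eigenbasis_const la IH; rewrite cE.
suff -> : c = 0 by rewrite scale0r.
(* Here n > m, so the band window n - m, ..., n + 1 omits index 0; the constant c p_0 lies in its
   span and must vanish. *)
apply: (pspan_const_eq0 size_eigenbasis (n := n.+2)).
rewrite -cE actDl actNl.
have -> : act (g * op_S K) (p n) = p n.+1 + n%:R *: p n - 'X * p n.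
  by rewrite eigenbasis_mulX opprB addrC subrK.
have span1 f : pspan p (n - m) n.+2 f -> pspan p 1 n.+2 f.
  case=> d ->; rewrite big_nat; apply: pspan_sum => k k_in.
  by apply/pspanZ/pspan_mem; lia.
by apply/span1/pspanB/span_q/sq; apply/pspanB/band.
Qed.

(** The substitutions S = D + 1 and D = S - 1 preserve degree, so the bound on gS may be read in
    powers of S. *)
Lemma lower_banded_support m : lower_banded p m <->
  (forall j : int, g@_j != 0 -> - 1 <= j < m%:Z).
Proof.
rewrite lower_bandedP -polyS_supportP //; split=> -[q sq ->].
  exists (q \Po ('X - 1)); last exact: horner_alg_shift.
  by rewrite size_comp_poly2 // size_XsubC.
exists (q \Po ('X + 1)); first by rewrite size_comp_poly2 // size_XaddC.
rewrite horner_alg_shift -comp_polyA comp_polyD comp_polyX.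
by rewrite comp_polyC subrK comp_polyXr.
Qed.

End EigenbasisRelations.

(** * Extremal exponents of H and E in terms of those of Y *)

Section ExtremalExponents.
Variable K : fieldType.
Implicit Types (a : shiftop K) (j k d e : int).

Lemma nu_minusE a e :
  a@_e != 0 -> (forall j, j < e -> a@_j = 0) -> nu_minus a = e.
Proof.
move=> ae a0; have [|nz le_nu] := @nu_minusP _ a.
  by apply: contraNneq ae => ->; rewrite mcoeff0.
apply/le_anti; rewrite le_nu //= leNgt; apply/negP => /a0 nu0.
by rewrite nu0 eqxx in nz.
Qed.

Lemma nu_plusE a d :
  a@_d != 0 -> (forall j, d < j -> a@_j = 0) -> nu_plus a = d.
Proof.
move=> ad a0; have [|nz ge_nu] := @nu_plusP _ a.
  by apply: contraNneq ad => ->; rewrite mcoeff0.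
apply/le_anti; rewrite ge_nu // andbT leNgt; apply/negP => /a0 nu0.
by rewrite nu0 eqxx in nz.
Qed.

Lemma coef_lt_nu_minus a j : a != 0 -> j < nu_minus a -> a@_j = 0.
Proof.
move=> /nu_minusP[_ le_nu] lt_j; apply/eqP.
by apply: contraTT lt_j => /le_nu; rewrite -leNgt.
Qed.

Lemma coef_gt_nu_plus a j : a != 0 -> nu_plus a < j -> a@_j = 0.
Proof.
move=> /nu_plusP[_ ge_nu] lt_j; apply/eqP.
by apply: contraTT lt_j => /ge_nu; rewrite -leNgt.
Qed.

Lemma shiftp_eq0 j (t : {poly K}) : (shiftp j t == 0) = (t == 0).
Proof.
apply/eqP/eqP => [t0|->]; last exact: shiftp0.
by rewrite -[t]shiftp_id -(addNr j) -shiftp_shiftp t0 shiftp0.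
Qed.

Variables (g : shiftop K) (lambda : K).
Hypothesis hg : laurentS g.
Let Y : shiftop K := op_X K + g.

Let Y_coef k : Y@_k = (if k == - 1 then 'X else 0) + g@_k.
Proof. by rewrite mcoeffD coef_op_X. Qed.

Let Y_coefN1 : exists c : K, Y@_(- 1) = 'X + c%:P.
Proof. by have [c gc] := hg (- 1); exists c; rewrite Y_coef gc. Qed.

Lemma raising_coefN1_neq0 : Y@_(- 1) != 0.
Proof. by have [c ->] := Y_coefN1; rewrite -size_poly_eq0 size_XaddC. Qed.

Let Y_neq0 : Y != 0.
Proof. by apply: contraNneq raising_coefN1_neq0 => ->; rewrite mcoeff0. Qed.

Lemma nu_minus_raising_le : nu_minus Y <= - 1.
Proof. by have [_ ->] := nu_minusP Y_neq0; last exact: raising_coefN1_neq0. Qed.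

Lemma nu_plus_raising_ge : - 1 <= nu_plus Y.
Proof. by have [_ ->] := nu_plusP Y_neq0; last exact: raising_coefN1_neq0. Qed.

Lemma coef_opH k : (opH g lambda)@_k =
  2%:R *: (Y@_(k - 1) - Y@_k) - (if k == 0 then lambda%:P else 0).
Proof.
by rewrite opHE mcoeffB mcoeffMn coef_opMD op_scalar_term coef_term scaler_nat.
Qed.

Lemma coef_opE k : (opE g lambda)@_k =
  (Y * Y)@_(k - 1) - (Y * Y)@_k - lambda *: Y@_k.
Proof. by rewrite /opE mcoeffB coef_opMD coef_opZ. Qed.

(** Two exponents of Y, each at most nu_+(Y), can add up to such a k only if both equal nu_+(Y). *)
Let Ysqr_top k : 2 * nu_plus Y <= k ->
  (Y * Y)@_k =
    if k == 2 * nu_plus Y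
    then Y@_(nu_plus Y) * shiftp (nu_plus Y) Y@_(nu_plus Y) else 0.
Proof.
move=> le_k; pose d := k - nu_plus Y.
have {1}-> : k = d + nu_plus Y by rewrite subrK.
rewrite coef_opM_extremal => [|j /(proj2 (nu_plusP Y_neq0)) le_j /eqP ne_jd].
  case: eqP => [kE|ne_k]; first by have -> : d = nu_plus Y by rewrite /d; lia.
  by rewrite (@coef_gt_nu_plus Y d) ?mul0r // /d; lia.
by apply: coef_gt_nu_plus => //; rewrite /d in ne_jd *; lia.
Qed.

Let Ysqr_bottom k : k <= 2 * nu_minus Y ->
  (Y * Y)@_k =
    if k == 2 * nu_minus Y
    then Y@_(nu_minus Y) * shiftp (nu_minus Y) Y@_(nu_minus Y) else 0.
Proof.
move=> le_k; pose d := k - nu_minus Y.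
have {1}-> : k = d + nu_minus Y by rewrite subrK.
rewrite coef_opM_extremal => [|j /(proj2 (nu_minusP Y_neq0)) le_j /eqP ne_jd].
  case: eqP => [kE|ne_k]; first by have -> : d = nu_minus Y by rewrite /d; lia.
  by rewrite (@coef_lt_nu_minus Y d) ?mul0r // /d; lia.
by apply: coef_lt_nu_minus => //; rewrite /d in ne_jd *; lia.
Qed.

(** Y and g differ only at S^-1, an exponent that the window always allows and that Y always has. *)
Lemma raising_support m :
  (forall j, g@_j != 0 -> - 1 <= j < m%:Z) <->
  nu_minus Y = - 1 /\ nu_plus Y < m%:Z.
Proof.
have [Ye le_e] := nu_minusP Y_neq0; have [Yd ge_d] := nu_plusP Y_neq0.
have supp j : (Y@_j != 0) -> j = - 1 \/ g@_j != 0.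
  by rewrite Y_coef; case: (j =P - 1) => [|_]; [left | rewrite add0r; right].
split=> [g_supp | [eE lt_d] j gj].
  have := nu_minus_raising_le.
  by have [|/g_supp] := supp _ Ye; have [|/g_supp] := supp _ Yd; lia.
have [->|jN1] := eqVneq j (- 1); first by lia.
have Yj : Y@_j != 0 by rewrite Y_coef (negPf jN1) add0r.
by have := le_e _ Yj; have := ge_d _ Yj; lia.
Qed.

(** As nu_-(Y) <= -1, the exponent 2 nu_-(Y) lies strictly below nu_-(Y), out of reach of the term
    lambda Y. *)
Lemma nu_minus_opE : nu_minus (opE g lambda) = 2 * nu_minus Y.
Proof.
have [Ye _] := nu_minusP Y_neq0; have le_e := nu_minus_raising_le.
have E_low j : j <= 2 * nu_minus Y -> (opE g lambda)@_j = - (Y * Y)@_j.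
  move=> le_j; rewrite coef_opE.
  rewrite [(Y * Y)@_(_ - 1)]Ysqr_bottom ?ifF ?sub0r; try lia.
  by rewrite (@coef_lt_nu_minus Y) ?scaler0 ?subr0 //; lia.
apply: nu_minusE => [|j lt_j].
  by rewrite E_low // Ysqr_bottom // eqxx oppr_eq0 mulf_neq0 // shiftp_eq0.
by rewrite E_low ?Ysqr_bottom 1?ltW // lt_eqF // oppr0.
Qed.

Lemma nu_plus_opE : nu_plus (opE g lambda) = 2 * nu_plus Y + 1.
Proof.
have [Yd _] := nu_plusP Y_neq0; have ge_d := nu_plus_raising_ge.
have Y0 j : nu_plus Y < j -> Y@_j = 0 by exact: coef_gt_nu_plus.
have Ysqr0 j : 2 * nu_plus Y < j -> (Y * Y)@_j = 0.
  by move=> lt_j; rewrite Ysqr_top ?ltW // gt_eqF.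
apply: nu_plusE => [|j lt_j]; rewrite coef_opE; last first.
  by rewrite !Ysqr0 ?[Y@_j]Y0 ?scaler0 ?subr0 //; lia.
rewrite addrK [(Y * Y)@_(2 * _)]Ysqr_top // eqxx Ysqr0 ?subr0; last by lia.
(* If nu_+(Y) = -1, then lambda Y also reaches the top exponent -1; with x + c the coefficient of Y
   there, that of E is (x + c)(x + c - 1 - lambda), still nonzero. *)
have [dE|d_ge0] : nu_plus Y = - 1 \/ 0 <= nu_plus Y by lia.
  rewrite dE; have [c ->] := Y_coefN1.
  have shE : shiftp (- 1) ('X + c%:P) - lambda%:P = 'X + (c - 1 - lambda)%:P.
    by rewrite shiftpD shiftpC /shiftp comp_polyX mulrN1z !polyCB polyCN; ring.
  rewrite -mul_polyC [lambda%:P * _]mulrC -mulrBr shE.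
  by rewrite mulf_neq0 // -size_poly_eq0 size_XaddC.
by rewrite [Y@_(_ + 1)]Y0 ?scaler0 ?subr0 ?mulf_neq0 ?shiftp_eq0 //; lia.
Qed.

Hypothesis charK : [pchar K] =i pred0.

Let two_neq0 : 2%:R != 0 :> K.
Proof. by rewrite (natf_neq0_pchar0 charK). Qed.

(** The scalar lambda sits at exponent 0, strictly above nu_-(Y). *)
Lemma nu_minus_opH : nu_minus (opH g lambda) = nu_minus Y.
Proof.
have [Ye _] := nu_minusP Y_neq0; have le_e := nu_minus_raising_le.
have Y0 j : j < nu_minus Y -> Y@_j = 0 by exact: coef_lt_nu_minus.
have H_low j : j <= nu_minus Y -> (opH g lambda)@_j = - (2%:R *: Y@_j).
  move=> le_j; rewrite coef_opH [Y@_(_ - 1)]Y0; last by lia.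
  by rewrite sub0r scalerN ifF ?subr0 //; lia.
apply: nu_minusE => [|j lt_j].
  by rewrite H_low // oppr_eq0 scaler_eq0 negb_or two_neq0.
by rewrite H_low ?Y0 ?scaler0 ?oppr0 // ltW.
Qed.

Lemma nu_plus_opH : nu_plus (opH g lambda) = nu_plus Y + 1.
Proof.
have [Yd _] := nu_plusP Y_neq0; have ge_d := nu_plus_raising_ge.
have Y0 j : nu_plus Y < j -> Y@_j = 0 by exact: coef_gt_nu_plus.
apply: nu_plusE => [|j lt_j]; rewrite coef_opH; last first.
  by rewrite !Y0 ?subr0 ?scaler0 ?sub0r ?ifF ?oppr0 //; lia.
rewrite addrK [Y@_(_ + 1)]Y0 ?subr0; last by lia.
(* The scalar lambda meets the top exponent only if nu_+(Y) = -1; the coefficient is then 2(x + c) -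
   lambda, whose coefficient of x is 2. *)
case: (nu_plus Y + 1 =P 0) => [dE|_]; last first.
  by rewrite subr0 scaler_eq0 negb_or two_neq0.
have -> : nu_plus Y = - 1 by lia.
have [c ->] := Y_coefN1; apply: contraTneq two_neq0.
move/(congr1 (fun q : {poly K} => q`_1)).
rewrite !(coefB, coefD, coefZ, coefX, coefC, coef0) /= subr0 addr0 mulr1 => ->.
by rewrite eqxx.
Qed.

End ExtremalExponents.

(** * Reduction of the four conditions to nu_-(Y) = -1, and the value of the bandwidth *)

Theorem theorem5p4 (K : fieldType) (charK : [pchar K] =i pred0)
    (g : shiftop K) (hg : laurentS g) (lambda : K)
    (p : nat -> {poly K}) (hp : monic_eigenbasis g lambda p)
    (r : option nat) (hr : lower_bandwidth p r) :
  [<-> r <> None;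
       Sinv_polyS g;
       nu_minus (opH g lambda) = - 1;
       nu_minus (opE g lambda) = - 2] /\
  (r <> None ->
     exists2 m : nat, r = Some m
       & nu_plus (opH g lambda) = m%:Z /\
         nu_plus (opE g lambda) = 2 * m%:Z - 1).
Proof.
have bandP m : lower_banded p m <->
    nu_minus (op_X K + g) = - 1 /\ nu_plus (op_X K + g) < m%:Z.
  by rewrite (lower_banded_support charK hg hp) (raising_support hg).
have ge_d := nu_plus_raising_ge hg.
have SinvP : Sinv_polyS g <-> nu_minus (op_X K + g) = - 1.
  rewrite Sinv_polySE; split=> [[q gq]|eE].
    have : exists2 q' : {poly K},
        (size q' <= (size q).+1)%N & g * op_S K = horner_alg (op_S K) q'.
      by exists q.
    by rewrite polyS_supportP // raising_support // => -[].
  have [|q _ gq] := (polyS_supportP (absz (nu_plus (op_X K + g) + 1)) hg).2.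
    by rewrite raising_support //; split=> //; lia.
  by exists q.
have bandwidthP : r <> None <-> nu_minus (op_X K + g) = - 1.
  case: r hr => [m [/bandP[] //]|no_band]; split=> // eE _.
  (* nu_+(Y) + 1 is nonnegative, so [absz] leaves it unchanged; it is the least m with nu_+(Y) <
     m. *)
  apply: (no_band (absz (nu_plus (op_X K + g) + 1))); apply/bandP.
  by split=> //; lia.
split.
  rewrite !(nu_minus_opH, nu_minus_opE) //; tfae.
  - by move/bandwidthP/SinvP.
  - by move/SinvP.
  - by move->.
  - by move=> e2; apply/bandwidthP; lia.
case: r hr {bandwidthP} => // m [/bandP[eE lt_d] min_m] _; exists m => //.
rewrite nu_plus_opH // nu_plus_opE //.
(* Minimality gives m <= nu_+(Y) + 1, and [lt_d] gives the reverse inequality. *)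
have /min_m : lower_banded p (absz (nu_plus (op_X K + g) + 1)).
  by apply/bandP; split=> //; lia.
by lia.
Qed.
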